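(* Let $\omega,\gamma\in\mathbb{R}$ and let $u=u(t,x)$, $(t,x)\in[0,T)\times\mathbb{R}$, be a solution of the DGH equation $$u_t-u_{txx}+2\omega u_x+3uu_x+\gamma u_{xxx}=2u_xu_{xx}+uu_{xxx}$$ such that $u$ is bounded, $(\partial_x\Lambda^{-2}u)(t,\cdot)\in C^1(\mathbb{R})$ for each $t\in[0,T)$, and $\|u(t,\cdot)\|_{H^1(\mathbb{R})}$ is independent of $t\in[0,T)$. If $\omega+\gamma/2=0$ and the function $x\mapsto u(t,x)$ has compact support for each $t\in[0,T)$, then $u\equiv 0$.
   Context: $\Lambda^{2}=1-\partial_x^2$ is the Helmholtz operator, with inverse $\Lambda^{-2}f=g\ast f$ where $g(x)=e^{-|x|}/2$ on $\mathbb{R}$; and $\|v\|_{H^1(\mathbb{R})}^2=\int_{\mathbb{R}}(v^2+v_x^2)\,dx$. When $\gamma=-2\omega$ the DGH equation can be written in the non-local form $u_t+(u+2\omega)u_x=-\partial_x\Lambda^{-2}\left(u^2+\frac{u_x^2}{2}\right)$. *)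

(* Defs.v *)
From HB Require Import structures.
From mathcomp Require Import all_boot all_order all_algebra.
From mathcomp Require Import all_classical all_reals all_analysis.
Import Order.TTheory GRing.Theory Num.Theory.
Import numFieldNormedType.Exports.

Set Implicit Arguments.
Unset Strict Implicit.
Unset Printing Implicit Defensive.

Local Open Scope ring_scope.
Local Open Scope classical_set_scope.

Definition compactly_supported (X : topologicalType) (R : realType)
    (f : X -> R) : Prop :=
  compact (closure [set x | f x != 0]).

Definition test_function (R : realType) (psi : R -> R) : Prop :=
  (forall (n : nat) (x : R), derivable (derive1n n psi) x 1) /\
  compactly_supported psi.

Definition is_weak_derivative (R : realType) (v vx : R -> R) : Prop :=
  forall psi : R -> R, test_function psi ->
    \int[@lebesgue_measure R]_x (v x * derive1 psi x) =
    - \int[@lebesgue_measure R]_x (vx x * psi x).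

(* [v] belongs to $H^1(\mathbb R)$ and [vx] represents its weak derivative,
   which is unique only up to equality almost everywhere. *)
Definition in_H1 (R : realType) (v vx : R -> R) : Prop :=
  [/\ v \in Lfun (@lebesgue_measure R) 2%:E,
      vx \in Lfun (@lebesgue_measure R) 2%:E &
      is_weak_derivative v vx].

Definition H1norm (R : realType) (v vx : R -> R) : R :=
  Num.sqrt (\int[@lebesgue_measure R]_x (v x ^+ 2 + vx x ^+ 2)).

(* $\Lambda^{-2} f = g * f$ with $g(x) = e^{-|x|}/2$. *)
Definition helmholtz_inv (R : realType) (f : R -> R) : R -> R :=
  fun x => \int[@lebesgue_measure R]_y (expR (- `|x - y|) / 2 * f y).

Definition differentiable_on_line (R : realType) (f : R -> R) : Prop :=
  forall x : R, derivable f x 1.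

Definition C1 (R : realType) (f : R -> R) : Prop :=
  differentiable_on_line f /\ continuous (derive1 f).

Inductive direction := Dt | Dx.

Definition pderiv (R : realType) (d : direction) (phi : R -> R -> R) :
    R -> R -> R :=
  match d with
  | Dt => fun t x => derive1 (phi ^~ x) t
  | Dx => fun t x => derive1 (phi t) x
  end.

(* [pderivs [:: d1; d2; d3] phi] is $\partial_{d_1}\partial_{d_2}
   \partial_{d_3}\phi$. *)
Definition pderivs (R : realType) (w : seq direction) (phi : R -> R -> R) :
    R -> R -> R :=
  foldr (@pderiv R) phi w.

Definition smooth2 (R : realType) (phi : R -> R -> R) : Prop :=
  forall w : seq direction,
    [/\ continuous (uncurry (pderivs w phi)),
        forall t x : R, derivable (pderivs w phi ^~ x) t 1 &
        forall t x : R, derivable (pderivs w phi t) x 1].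

(* The lifespan [T] may be infinite. *)
Definition open_strip (R : realType) (T : \bar R) : set (R * R) :=
  [set z | 0 < z.1 /\ (z.1%:E < T)%E].

Definition halfopen_strip (R : realType) (T : \bar R) : set (R * R) :=
  [set z | 0 <= z.1 /\ (z.1%:E < T)%E].

Definition test_function2 (R : realType) (T : \bar R) (phi : R -> R -> R) :
    Prop :=
  [/\ smooth2 phi,
      compactly_supported (uncurry phi) &
      closure [set z | uncurry phi z != 0] `<=` open_strip T].

(* The value at the test function [phi] of the distribution
   $\partial_w f$ on $(0,T)\times\mathbb R$, for [f] locally integrable:
   $(-1)^{|w|}\iint f\,\partial_w\phi$. *)
Definition dist_deriv (R : realType) (T : \bar R) (w : seq direction)
    (f phi : R -> R -> R) : R :=
  (-1) ^+ size w *
  \int[(@lebesgue_measure R \x @lebesgue_measure R)%E]_(z in open_strip T)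
     (f z.1 z.2 * pderivs w phi z.1 z.2).

(* Solutions on $[0,T)\times\mathbb R$ of
     $u_t - u_{txx} + 2\omega u_x + 3uu_x + \gamma u_{xxx}
        = 2u_xu_{xx} + uu_{xxx}$
   in the sense of distributions.  The only regularity required is that [u] be
   continuous, with $u(t,\cdot)\in H^1(\mathbb R)$ and $u_x\in L^2_{loc}$, so
   that classical solutions with these properties, and strong solutions in
   $C([0,T);H^s)\cap C^1([0,T);H^{s-1})$ with $s>3/2$, are included.  At this
   regularity the nonlinear terms have a meaning through
     $3uu_x = \frac32\partial_x(u^2)$ and
     $2u_xu_{xx} + uu_{xxx}
        = \frac12\partial_x^3(u^2) - \frac12\partial_x(u_x^2)$. *)
Record DGH_solution (R : realType) (omega gamma : R) (T : \bar R)
    (u ux : R -> R -> R) : Prop := {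
  DGH_continuous : {within halfopen_strip T, continuous (uncurry u)} ;
  DGH_H1 : forall t : R, 0 <= t -> (t%:E < T)%E -> in_H1 (u t) (ux t) ;
  DGH_measurable : measurable_fun (open_strip T) (uncurry ux) ;
  DGH_L2loc : forall K : set (R * R), compact K -> K `<=` open_strip T ->
    (@lebesgue_measure R \x @lebesgue_measure R)%E.-integrable K
      (fun z => (ux z.1 z.2 ^+ 2)%:E) ;
  DGH_equation : forall phi, test_function2 T phi ->
    let usq := fun t x => u t x ^+ 2 in
    let uxsq := fun t x => ux t x ^+ 2 in
    dist_deriv T [:: Dt] u phi
      - dist_deriv T [:: Dt; Dx; Dx] u phi
      + 2 * omega * dist_deriv T [:: Dx] u phi
      + 3 / 2 * dist_deriv T [:: Dx] usq phi
      + gamma * dist_deriv T [:: Dx; Dx; Dx] u phi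
    = 1 / 2 * dist_deriv T [:: Dx; Dx; Dx] usq phi
      - 1 / 2 * dist_deriv T [:: Dx] uxsq phi }.

(* Main.v *)
(* Let [u(t, .)] vanish for [|x| >= N] during a whole time interval, and test the
   equation with [phi(t, x) = theta(t) psi(x)], [psi = exp] on [|x| < N + 1].
   There [psi = psi''], so for [gamma = - 2 omega] all that survives is
   [int int (u^2 + u_x^2 / 2) theta e^x = 0], whence [u = 0] on that interval.
   The hypotheses give supports that are compact but not uniformly so in time;
   Baire's theorem provides a time interval on which they are uniformly bounded.
   Conservation of the H^1 norm then spreads [u = 0] to all times. *)

Require Import Defs.
From HB Require Import structures.
From mathcomp Require Import all_boot all_order all_algebra.
From mathcomp Require Import all_classical all_reals all_analysis.
From mathcomp Require Import measurable_realfun ring lra.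
Import Order.TTheory GRing.Theory Num.Theory.
Import numFieldNormedType.Exports.
Local Open Scope ring_scope.
Local Open Scope classical_set_scope.

(** * Smooth cutoff functions *)

(** The choice of [exp] is twofold: it lies in the kernel of [1 - d_x^2], and its derivative is
    positive, which gives both quadratic terms a sign. Cutting it off costs the sign: [psi'] may be
    negative in the layer where [psi] falls to 0. There [u] is 0, but [ux t] is merely some
    representative of the weak derivative at each time, so it has to be shown null almost
    everywhere, in [x] and then in [(t, x)]. Real integrals are [fine] of extended ones, and [fine]
    sends infinite values to 0. Before a vanishing real integral says anything, finiteness must be
    known; for [u^2] it comes from the bound on [u] and the uniform support. Test functions need
    derivatives of every order. They are taken from a class closed under differentiation, whose
    seeds include [x^-k e^(-1/x)] on [x > 0]; the powers are there because differentiating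
    [e^(-1/x)] creates them. *)

Definition flat (R : realType) (k : nat) (x : R) : R :=
  if 0 < x then x^-1 ^+ k * expR (- x^-1) else 0.
Arguments flat {R} k x.

Lemma flat_le0 (R : realType) (k : nat) (x : R) : x <= 0 -> flat k x = 0.
Proof. by move=> x0; rewrite /flat ltNge x0. Qed.

Lemma flat_gt0 (R : realType) (k : nat) (x : R) : 0 < x -> 0 < flat k x.
Proof. by move=> x0; rewrite /flat x0 mulr_gt0 ?expR_gt0// exprn_gt0// invr_gt0. Qed.

Lemma flat_ge0 (R : realType) (k : nat) (x : R) : 0 <= flat k x.
Proof.
by have [x0|x0] := ltP 0 x; [exact/ltW/flat_gt0|rewrite flat_le0].
Qed.

Lemma flatS (R : realType) (k : nat) (x : R) : flat k.+1 x = x^-1 * flat k x.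
Proof. by rewrite /flat; case: ifP => _; rewrite ?mulr0// exprS mulrA. Qed.

(** With [y = x^-1] this is [y^(k+1) / (k+1)! <= e^y]. It serves to differentiate [flat k] at 0. *)
Lemma flat_le_linear (R : realType) (k : nat) (x : R) :
  `|flat k x| <= k.+1`!%:R * `|x|.
Proof.
rewrite ger0_norm ?flat_ge0//.
have [x0|x0] := ltP 0 x; last by rewrite flat_le0 // mulr_ge0.
rewrite /flat x0 gtr0_norm// expRN ler_pdivrMr ?expR_gt0// -ler_pdivrMl; last first.
  by rewrite mulr_gt0// ltr0n fact_gt0.
rewrite invfM -mulrA -exprS mulrC.
apply: le_trans (expR_ge1Dxn k _); last by rewrite invr_ge0 ltW.
by rewrite lerDr ler01.
Qed.

Lemma is_derive_flat (R : realType) (k : nat) (x : R) :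
  is_derive x 1 (flat k) (flat k.+2 x - k%:R * flat k.+1 x).
Proof.
have [x0|x0|->] := ltgtP x 0.
- rewrite !flat_le0 ?ltW// mulr0 subr0.
  apply: (@near_eq_is_derive _ _ _ (cst 0)).
  near=> y; rewrite flat_le0//; near: y; exact: (lt_le_nbhsl x0).
- have D : is_derive x 1 (fun y : R => y^-1 ^+ k * expR (- y^-1))
      (flat k.+2 x - k%:R * flat k.+1 x).
    have Dinv : is_derive x 1 (fun y : R => y^-1) (- x ^- 2 *: 1).
      by apply: is_deriveV; rewrite gt_eqF.
    have De := is_derive1_comp (is_derive_expR ((- (fun y : R => y^-1)) x))
      (is_deriveN Dinv).
    rewrite (_ : (fun y : R => _) =
      (fun y : R => y^-1) ^+ k * (expR \o - (fun y : R => y^-1))); last first.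
      by apply/funext => y; rewrite !fctE.
    apply: is_derive_eq (is_deriveM (is_deriveX k Dinv) De) _.
    rewrite !flatS /flat x0 /GRing.scale /= !fctE !exprVn.
    case: k => [|k]; first by
      rewrite !mul0r mulr0 subr0 addr0 expr0; field; rewrite gt_eqF.
    rewrite /= [x ^+ k.+1]exprS; by field; rewrite ?expf_neq0 gt_eqF.
  apply: near_eq_is_derive D.
  near=> y; rewrite /flat ifT//; near: y; exact: lt_nbhsr.
- rewrite !flat_le0// mulr0 subr0.
  suff H : (h^-1 *: ((flat k \o shift 0) (h *: (1 : R)) - flat k (0 : R)))
      @[h --> 0^'] --> (0 : R).
    by apply: DeriveDef; [apply/cvg_ex; exists 0|apply/cvg_lim].
  (* The difference quotient of [flat k] at 0 is the next member of the family, and the linear bound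
     sends it to 0. *)
  rewrite (_ : (fun h => _) = flat k.+1); last first.
    apply/funext => h /=.
    by rewrite (flat_le0 _ _ 0)// subr0 addr0 /GRing.scale/= mulr1 flatS.
  apply/cvgr0Pnorm_le => e e0; near=> h.
  rewrite (le_trans (flat_le_linear _ _ _))// mulrC -ler_pdivlMr ?ltr0n ?fact_gt0//.
  near: h; apply: dnbhs0_le; by rewrite divr_gt0// ltr0n fact_gt0.
Unshelve. all: by end_near.
Qed.

(* Closed under differentiation by construction, so all its members are
   infinitely differentiable. *)
Inductive elementary {R : realType} : (R -> R) -> Prop :=
| elementary_cst c : elementary (fun=> c)
| elementary_id : elementary (fun x => x)
| elementary_expR : elementary expR
| elementary_flat k : elementary (flat k)
| elementaryD f g : elementary f -> elementary g ->
    elementary (fun x => f x + g x)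
| elementaryM f g : elementary f -> elementary g ->
    elementary (fun x => f x * g x)
| elementaryV f : (forall x, f x != 0) -> elementary f ->
    elementary (fun x => (f x)^-1)
| elementary_comp f g : elementary f -> elementary g ->
    elementary (fun x => f (g x)).

Lemma elementary_is_derive (R : realType) (f : R -> R) :
  elementary f -> exists2 g : R -> R, elementary g & forall x : R, is_derive x 1 f (g x).
Proof.
elim=> {f} [c|||k|f g Ef [f' Ef' df] Eg [g' Eg' dg]|f g Ef [f' Ef' df] Eg [g' Eg' dg]
  |f f0 Ef [f' Ef' df]|f g Ef [f' Ef' df] Eg [g' Eg' dg]].
- by exists (fun=> 0) => [|x]; [constructor|exact: is_derive_cst].
- by exists (fun=> 1) => [|x]; [constructor|exact: is_derive_id].
- by exists expR => [|x]; [constructor|exact: is_derive_expR].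
- exists (fun x => flat k.+2 x + (- k%:R) * flat k.+1 x).
    by apply: elementaryD; [|apply: elementaryM]; constructor.
  by move=> x; apply: is_derive_eq (is_derive_flat _ k x) _; rewrite mulNr.
- by exists (fun x => f' x + g' x) => [|x]; [exact: elementaryD|exact: is_deriveD].
- exists (fun x => f x * g' x + g x * f' x) => [|x].
    by apply: elementaryD; apply: elementaryM.
  exact: (is_deriveM (df x) (dg x)).
- exists (fun x => (-1 * ((f x)^-1 * (f x)^-1)) * f' x) => [|x].
    do 2?[apply: elementaryM => //]; first exact: elementary_cst.
    by apply: elementaryM; apply: elementaryV.
  apply: is_derive_eq (is_deriveV (f0 x) (df x)) _.
  by rewrite /GRing.scale/= mulN1r -invfM.
- exists (fun x => f' (g x) * g' x) => [|x].
    by apply: elementaryM => //; exact: elementary_comp.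
  exact: is_derive1_comp (df (g x)) (dg x).
Qed.

Lemma elementary_derive1 (R : realType) (f : R -> R) :
  elementary f -> elementary (derive1 f).
Proof.
move=> /elementary_is_derive[g Eg dg].
rewrite (_ : derive1 f = g)//; apply/funext => x.
by rewrite derive1E; have dgx := dg x; exact: derive_val.
Qed.

Lemma elementary_derive1n (R : realType) (n : nat) (f : R -> R) :
  elementary f -> elementary (derive1n n f).
Proof.
by move=> Ef; elim: n => [|n ih]; rewrite ?derive1nS//; exact: elementary_derive1.
Qed.

Lemma elementary_derivable (R : realType) (f : R -> R) (x : R) :
  elementary f -> derivable f x 1.
Proof. by move=> /elementary_is_derive[g _ dg]; have := dg x => ?. Qed.

Lemma elementary_continuous (R : realType) (f : R -> R) :
  elementary f -> continuous f.
Proof.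
by move=> Ef x; exact/differentiable_continuous/derivable1_diffP/elementary_derivable.
Qed.

(** The usual smooth transition from 0 on [x <= 0] to 1 on [1 <= x]. The denominator is positive
    because [x] and [1 - x] are never both nonpositive. *)
Definition step (R : realType) (x : R) : R :=
  flat 0 x / (flat 0 x + flat 0 (1 - x)).
Arguments step {R} x.

Lemma step_den_gt0 (R : realType) (x : R) : 0 < flat 0 x + flat 0 (1 - x).
Proof.
have [x0|x0] := ltP 0 x; first by rewrite ltr_wpDr ?flat_ge0 ?flat_gt0.
by rewrite ltr_wpDl ?flat_ge0// flat_gt0//; lra.
Qed.

Lemma step_le0 (R : realType) (x : R) : x <= 0 -> step x = 0.
Proof. by move=> x0; rewrite /step flat_le0// mul0r. Qed.

Lemma step_ge1 (R : realType) (x : R) : 1 <= x -> step x = 1.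
Proof.
move=> x1; rewrite /step (flat_le0 _ _ (1 - x)); last by rewrite subr_le0.
by rewrite addr0 divff// gt_eqF// flat_gt0// (lt_le_trans ltr01).
Qed.

Lemma step_ge0 (R : realType) (x : R) : 0 <= step x.
Proof. by rewrite divr_ge0 ?flat_ge0// ltW// step_den_gt0. Qed.

Lemma step_le1 (R : realType) (x : R) : step x <= 1.
Proof. by rewrite ler_pdivrMr ?step_den_gt0// mul1r lerDl flat_ge0. Qed.

Lemma elementaryB (R : realType) (f g : R -> R) :
  elementary f -> elementary g -> elementary (fun x => f x - g x).
Proof.
move=> Ef Eg; rewrite (_ : (fun x => _) = fun x => f x + (-1) * g x).
  by apply: elementaryD => //; apply: elementaryM => //; exact: elementary_cst.
by apply/funext => x; rewrite mulN1r.
Qed.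

Lemma elementary_step (R : realType) : elementary (@step R).
Proof.
have E1 : elementary (fun x : R => flat 0 (1 - x)).
  apply: (elementary_comp (flat 0) (fun x : R => 1 - x)).
    exact: elementary_flat.
  by apply: elementaryB; [exact: elementary_cst|exact: elementary_id].
apply: elementaryM; first exact: elementary_flat.
apply: elementaryV => [x|]; first by rewrite gt_eqF// step_den_gt0.
by apply: elementaryD => //; exact: elementary_flat.
Qed.

(** [k] is the steepness: the layers at both ends of []p, q[] have width [k^-1], so large [k]
    approximates the indicator of the interval. *)
Definition cutoff (R : realType) (p q k x : R) : R :=
  step (k * (x - p)) * step (k * (q - x)).
Arguments cutoff {R} p q k x.

Lemma elementary_cutoff (R : realType) (p q k : R) :
  elementary (cutoff p q k).
Proof.
apply: elementaryM.
  apply: (elementary_comp step (fun x : R => k * (x - p))).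
    exact: elementary_step.
  apply: elementaryM; first exact: elementary_cst.
  by apply: elementaryB; [exact: elementary_id|exact: elementary_cst].
apply: (elementary_comp step (fun x : R => k * (q - x))).
  exact: elementary_step.
apply: elementaryM; first exact: elementary_cst.
by apply: elementaryB; [exact: elementary_cst|exact: elementary_id].
Qed.

Lemma cutoff_ge0 (R : realType) (p q k x : R) : 0 <= cutoff p q k x.
Proof. by rewrite mulr_ge0 ?step_ge0. Qed.

Lemma cutoff_le1 (R : realType) (p q k x : R) : cutoff p q k x <= 1.
Proof. by rewrite mulr_ile1 ?step_ge0 ?step_le1. Qed.

Lemma cutoff_out (R : realType) (p q k x : R) :
  0 <= k -> ~~ (p < x < q) -> cutoff p q k x = 0.
Proof.
move=> k0; rewrite negb_and -!leNgt /cutoff => /orP[xp|qx].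
  by rewrite step_le0 ?mul0r// mulr_ge0_le0// subr_le0.
by rewrite [X in _ * X]step_le0 ?mulr0// mulr_ge0_le0// subr_le0.
Qed.

Lemma cutoff_in (R : realType) (p q k x : R) : 0 < k ->
  p + k^-1 <= x <= q - k^-1 -> cutoff p q k x = 1.
Proof.
move=> k0 /andP[px xq]; rewrite /cutoff !step_ge1 ?mulr1//.
  by rewrite -ler_pdivrMl// mulr1; lra.
by rewrite -ler_pdivrMl// mulr1; lra.
Qed.

(** * Test functions on the line and their tensor products *)

Lemma compactly_supported_sub (R : realType) (X : topologicalType) (f : X -> R)
    (K : set X) : hausdorff_space X -> compact K ->
  (forall x, ~ K x -> f x = 0) -> closure [set x | f x != 0] `<=` K.
Proof.
move=> hX cK fK; have clK := compact_closed hX cK.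
rewrite closureE; apply: smallest_sub => // x /= fx0.
by apply: contrapT => /fK fx; rewrite fx eqxx in fx0.
Qed.

Lemma compactly_supportedP (R : realType) (X : topologicalType) (f : X -> R)
    (K : set X) : hausdorff_space X -> compact K ->
  (forall x, ~ K x -> f x = 0) -> compactly_supported f.
Proof.
move=> hX cK fK; apply: (subclosed_compact _ cK); first exact: closed_closure.
exact: compactly_supported_sub.
Qed.

Lemma elementary_test_function (R : realType) (f : R -> R) (p q : R) :
  elementary f -> (forall x, ~~ (p < x < q) -> f x = 0) -> test_function f.
Proof.
move=> Ef f0; split=> [n x|].
  by apply: elementary_derivable; exact: elementary_derive1n.
apply: (@compactly_supportedP _ _ _ `[p, q]) => //.
- exact: segment_compact.
- move=> x xpq; apply: f0; apply/negP => /andP[px xq]; apply: xpq.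
  by rewrite /= in_itv/= !ltW.
Qed.

Definition tensor (R : realType) (theta psi : R -> R) : R -> R -> R :=
  fun t x => theta t * psi x.
Arguments tensor {R} theta psi.

Lemma pderiv_Dt_tensor (R : realType) (theta psi : R -> R) :
  elementary theta ->
  pderiv Dt (tensor theta psi) = tensor (derive1 theta) psi.
Proof.
move=> Et; apply/funext => t; apply/funext => x /=; rewrite /tensor.
by rewrite derive1Mr//; exact: elementary_derivable.
Qed.

Lemma pderiv_Dx_tensor (R : realType) (theta psi : R -> R) :
  elementary psi ->
  pderiv Dx (tensor theta psi) = tensor theta (derive1 psi).
Proof.
move=> Ep; apply/funext => t; apply/funext => x /=; rewrite /tensor.
by rewrite derive1Ml//; exact: elementary_derivable.
Qed.

(** Each derivative falls on one factor and leaves it elementary. Smoothness quantifies over all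
    words [w], so the shape of the result is all that has to be recorded. *)
Lemma pderivs_tensor (R : realType) (w : seq direction) (theta psi : R -> R) :
  elementary theta -> elementary psi ->
  exists theta' psi' : R -> R, [/\ elementary theta', elementary psi' &
    pderivs w (tensor theta psi) = tensor theta' psi'].
Proof.
move=> Et Ep; elim: w => [|d w [th [ps [Eth Eps E]]]]; first by exists theta, psi.
rewrite /= -/(pderivs w _) E; case: d.
- exists (derive1 th), ps; rewrite pderiv_Dt_tensor//; split => //.
  exact: elementary_derive1.
- exists th, (derive1 ps); rewrite pderiv_Dx_tensor//; split => //.
  exact: elementary_derive1.
Qed.

Lemma smooth2_tensor (R : realType) (theta psi : R -> R) :
  elementary theta -> elementary psi -> smooth2 (tensor theta psi).
Proof.
move=> Et Ep w; have [th [ps [Eth Eps ->]]] := pderivs_tensor _ w _ _ Et Ep.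
split.
- rewrite (_ : uncurry _ = (th \o fst) \* (ps \o snd)); last first.
    by apply/funext => -[].
  move=> z; apply: (@continuousM R (R * R)%type (th \o fst) (ps \o snd) z).
    by apply: continuous_comp; [exact: cvg_fst|exact: elementary_continuous].
  by apply: continuous_comp; [exact: cvg_snd|exact: elementary_continuous].
- move=> t x; apply: elementary_derivable; apply: elementaryM => //.
  exact: elementary_cst.
- move=> t x; apply: elementary_derivable; apply: elementaryM => //.
  exact: elementary_cst.
Qed.

Lemma tensor_test_function2 (R : realType) (T : \bar R) (theta psi : R -> R)
    (a b p q : R) : 0 < a -> (b%:E < T)%E ->
  elementary theta -> elementary psi ->
  (forall t, ~~ (a < t < b) -> theta t = 0) ->
  (forall x, ~~ (p < x < q) -> psi x = 0) ->
  test_function2 T (tensor theta psi).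
Proof.
move=> a0 bT Et Ep t0 p0.
have cK : compact (`[a, b] `*` `[p, q]).
  by apply: compact_setX; exact: segment_compact.
have K0 z : ~ (`[a, b] `*` `[p, q]) z -> uncurry (tensor theta psi) z = 0.
  case: z => t x /= K.
  have [tab|/t0] := boolP (a < t < b); last by rewrite /tensor => ->; rewrite mul0r.
  have [xpq|/p0] := boolP (p < x < q); last by rewrite /tensor => ->; rewrite mulr0.
  exfalso; apply: K; rewrite /= !in_itv/=; case/andP: tab => ? ?; case/andP: xpq => ? ?.
  by rewrite !ltW.
have hRR : hausdorff_space (R * R)%type.
  exact: norm_hausdorff.
split.
- exact: smooth2_tensor.
- exact: compactly_supportedP K0.
- apply: subset_trans (compactly_supported_sub _ _ _ _ hRR cK K0) _.
  move=> [t x] /= [+ _]; rewrite !in_itv/= => /andP[at_ tb].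
  by split; [exact: lt_le_trans at_|apply: le_lt_trans bT; rewrite lee_fin].
Qed.

(** * Weak derivatives vanish where the function does *)

(** A zero of a nonnegative function is a minimum. This covers the endpoints of the support of a
    cutoff, which have no neighbourhood on which the cutoff is 0. *)
Lemma derive1_at_zero_min (R : realType) (f : R -> R) (x : R) :
  (forall y, derivable f y 1) -> (forall y, 0 <= f y) -> f x = 0 ->
  derive1 f x = 0.
Proof.
move=> df f0 fx; have xx : x \in `]x - 1, x + 1[%R by rewrite in_itv/=; lra.
have [|||] := @derive1_at_min R f (x - 1) (x + 1) x _ _ xx.
- lra.
- by [].
- by move=> y _; rewrite fx.
- by move=> _; rewrite derive1E.
Qed.

Lemma Lfun2_integrable (R : realType) (f : R -> R) (A : set R) :
  f \in Lfun (@lebesgue_measure R) 2%:E -> measurable A ->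
  (@lebesgue_measure R A < +oo)%E ->
  (@lebesgue_measure R).-integrable A (EFin \o f).
Proof.
move=> f2 mA Aoo.
have mf : measurable_fun [set: R] f.
  by move: f2; rewrite inE => /andP[/[!inE]].
have int2 : (@lebesgue_measure R).-integrable A
    (fun x : R => (1%R)%:E + (f x ^+ 2)%:E)%E.
  apply: integrableD => //; last exact: integrableS (Lfun2_integrable_sqr f2).
  apply/integrableP; split => //.
  under eq_integral do rewrite /= normr1.
  by rewrite integral_cst// mul1e.
(* Domination by [|f| <= 1 + f^2], integrable since [A] has finite measure. *)
apply: le_integrable int2 => //.
- by apply/measurable_EFinP; exact: measurable_funS mf.
- move=> x _ /=; rewrite lee_fin [leRHS]ger0_norm ?addr_ge0 ?sqr_ge0//.
  rewrite -[f x ^+ 2]real_normK ?num_real//.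
  by have := sqr_ge0 (`|f x| - 1); have := normr_ge0 (f x); nra.
Qed.

Lemma Lfun2_locally_integrable (R : realType) (f : R -> R) :
  f \in Lfun (@lebesgue_measure R) 2%:E -> locally_integrable [set: R] f.
Proof.
move=> f2; split; [by move: f2; rewrite inE => /andP[/[!inE]]|exact: openT|].
move=> K _ cK.
have mK : measurable K := compact_measurable cK.
have [M [_ KM]] := compact_bounded cK.
have Koo : (@lebesgue_measure R K < +oo)%E.
  apply: (@le_lt_trans _ _ (@lebesgue_measure R `[- (M + 1), M + 1])); last first.
    by rewrite lebesgue_measure_itv/=; case: ifP => _; rewrite ?ltry.
  apply: le_measure; rewrite ?inE//.
  move=> x Kx; rewrite /= in_itv/= -ler_norml; apply: KM Kx.
  by rewrite ltrDl.
by have /integrableP[] := Lfun2_integrable _ _ _ f2 mK Koo.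
Qed.

(* Testing the weak derivative against smooth approximations of the indicator
   of [`]r, s[]. *)
Lemma weak_derivative_itv_integral (R : realType) (v vx : R -> R) (r s : R) :
  in_H1 v vx -> r < s -> (forall x, r < x < s -> v x = 0) ->
  (\int[@lebesgue_measure R]_(x in `]r, s[) (vx x)%:E = 0)%E.
Proof.
move=> [_ vx2 wd] rs v0.
have mD : measurable (`]r, s[%classic : set R) by exact: measurable_itv.
have ivx : (@lebesgue_measure R).-integrable `]r, s[ (EFin \o vx).
  apply: Lfun2_integrable => //.
  by rewrite lebesgue_measure_itv/=; case: ifP => _; rewrite ?ltry.
pose psi (n : nat) : R -> R := cutoff r s n.+1%:R.
have Epsi n : elementary (psi n) by exact: elementary_cutoff.
have psi0 n x : ~~ (r < x < s) -> psi n x = 0 by move=> ?; exact: cutoff_out.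
have mpsi n : measurable_fun [set: R] (psi n).
  by apply: continuous_measurable_fun; exact: elementary_continuous.
have mf n : measurable_fun `]r, s[ (fun x => (vx x * psi n x)%:E).
  apply/measurable_EFinP; apply: measurable_funM.
    by apply/measurable_EFinP; exact: measurable_int ivx.
  exact: measurable_funS (mpsi n).
have ineq n x : (`|(vx x * psi n x)%:E| <= `|(vx x)%:E|)%E.
  rewrite /= lee_fin normrM ler_piMr// ger0_norm ?cutoff_ge0//.
  exact: cutoff_le1.
have I0 n : (\int[@lebesgue_measure R]_(x in `]r, s[) (vx x * psi n x)%:E = 0)%E.
  (* The weak derivative only controls [fine] of this integral, which would be 0 for an infinite
     integral as well. *)
  have fin : (\int[@lebesgue_measure R]_(x in `]r, s[)
      (vx x * psi n x)%:E)%E \is a fin_num.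
    apply: integrable_fin_num => //.
    by apply: le_integrable ivx => //; exact: mf.
  rewrite -(fineK fin); congr (_%:E).
  suff : \int[@lebesgue_measure R]_(x in `]r, s[) (vx x * psi n x) = 0 by [].
  rewrite Rintegral_mkcond.
  rewrite (_ : _ \_ _ = fun x => vx x * psi n x); last first.
    apply/funext => x; rewrite patchE; case: ifPn => //.
    by rewrite notin_setE/= in_itv/= => /negP /psi0 ->; rewrite mulr0.
  (* Inside []r, s[] the factor [v] vanishes; elsewhere [psi n] is at its minimum 0. *)
  have vpsi x : v x * derive1 (psi n) x = 0.
    have [/v0 ->|xrs] := boolP (r < x < s); first by rewrite mul0r.
    rewrite derive1_at_zero_min ?mulr0//.
    - by move=> y; exact: elementary_derivable.
    - by move=> y; exact: cutoff_ge0.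
    - exact: psi0.
  have := wd (psi n) (elementary_test_function _ _ _ _ (Epsi n) (psi0 n)).
  rewrite [X in X = _](_ : _ = 0); last first.
    by rewrite /Rintegral integral0_eq// => x _; rewrite vpsi.
  by move=> /esym/eqP; rewrite oppr_eq0 => /eqP.
have fcvg : {ae @lebesgue_measure R, forall x : R, `]r, s[ x ->
    (vx x * psi n x)%:E @[n --> \oo] --> (EFin \o vx) x}.
  apply: aeW => x /=; rewrite in_itv/= => /andP[rx xs].
  (* At a fixed [x] the sequence is eventually constant: [psi n x = 1] once [1 / (n + 1)] is below
     the distance from [x] to the endpoints. *)
  have e0 : 0 < Num.min (x - r) (s - x) by by rewrite lt_min !subr_gt0 rx.
  apply: cvg_near_cst; near=> n; rewrite /= /psi cutoff_in ?mulr1//.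
  have : n.+1%:R^-1 < Num.min (x - r) (s - x).
    by near: n; exact: (near_infty_natSinv_lt (PosNum e0)).
  by rewrite lt_min => /andP[/ltW h1 /ltW h2]; rewrite -lerBrDl h1 lerBrDr -lerBrDl.
have fdom : {ae @lebesgue_measure R, forall x n, `]r, s[ x ->
    (`|(vx x * psi n x)%:E| <= `|(vx x)%:E|)%E}.
  by apply: aeW => x n _; exact: ineq.
have [_ _] := @dominated_convergence _ _ _ (@lebesgue_measure R) _ mD _ _ _ mf
  (measurable_int _ ivx) fcvg (integrable_abse ivx) fdom.
move=> /cvg_lim <-//.
by rewrite (_ : [sequence _]_n = fun=> 0%E) ?lim_cst//; apply/funext => n; exact: I0.
Unshelve. all: by end_near.
Qed.

(** The primitive [F] of [vx] from [p] is 0 on []p, q[], and at Lebesgue points of [vx], hence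
    almost everywhere, [vx] is the derivative of [F]. *)
Lemma weak_derivative_local (R : realType) (v vx : R -> R) (p q : R) :
  in_H1 v vx -> (forall x, p < x < q -> v x = 0) ->
  {ae (@lebesgue_measure R), forall x, p < x < q -> vx x = 0}.
Proof.
move=> H v0; have [_ vx2 _] := H.
have := lebesgue_differentiation (Lfun2_locally_integrable _ _ vx2).
apply: filterS; first exact: (ae_filter_ringOfSetsType (@lebesgue_measure R)).
move=> x vxx /andP[px xq].
pose F y := (\int[lebesgue_measure]_(t in `]p, y]) (vx t)).
have F0 y : p < y < q -> F y = 0.
  move=> /andP[py yq].
  rewrite /F -Rintegral_itv_bndo_bndc; last first.
    apply: Lfun2_integrable => //.
    by rewrite lebesgue_measure_itv/=; case: ifP => _; rewrite ?ltry.
  rewrite /Rintegral (weak_derivative_itv_integral _ v)// => z /andP[pz zy].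
  by apply: v0; rewrite pz (lt_trans zy).
have [|||_ <-] := @FTC1_lebesgue_pt _ vx (BRight p) x ((x + q) / 2) _ _ _ vxx.
- lra.
- apply: Lfun2_integrable => //.
  by rewrite lebesgue_measure_itv/=; case: ifP => _; rewrite ?ltry.
- by [].
rewrite derive1E (near_eq_derive _ (_ : \near x, _ x = cst 0 x)) ?derive_cst//.
near=> y; apply: F0; apply/andP; split; near: y; [exact: lt_nbhsr|exact: lt_nbhsl].
Unshelve. all: by end_near.
Qed.

(** * The energy identity *)

Lemma step_gt0 (R : realType) (x : R) : 0 < x -> 0 < step x.
Proof. by move=> x0; rewrite divr_gt0 ?step_den_gt0// flat_gt0. Qed.

Lemma cutoff_gt0 (R : realType) (p q k x : R) : 0 < k -> p < x < q ->
  0 < cutoff p q k x.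
Proof.
by move=> k0 /andP[px xq]; rewrite mulr_gt0// step_gt0// mulr_gt0// subr_gt0.
Qed.

Lemma eq_derive1_itv (R : realType) (f g : R -> R) (p q : R) :
  (forall x, p < x < q -> f x = g x) ->
  forall x, p < x < q -> derive1 f x = derive1 g x.
Proof.
move=> fg x /andP[px xq]; rewrite !derive1E; apply: near_eq_derive.
near=> y; apply: fg; apply/andP; split; near: y; [exact: lt_nbhsr|exact: lt_nbhsl].
Unshelve. all: by end_near.
Qed.

Lemma derive1_expR (R : realType) : derive1 (@expR R) = expR.
Proof. by apply/funext => x; rewrite derive1E derive_val. Qed.

(* [ge0_le_integral] without measurability: it spares us proving that functions
   continuous on the strip are measurable for the product sigma-algebra. *)
Lemma le_integral_ge0 d (X : measurableType d) (R : realType)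
    (mu : {measure set X -> \bar R}) (f g : X -> \bar R) :
  (forall x, (0 <= f x)%E) -> (forall x, (f x <= g x)%E) ->
  (\int[mu]_x f x <= \int[mu]_x g x)%E.
Proof.
move=> f0 fg; rewrite !ge0_integralTE//; last first.
  by move=> x; exact: le_trans (fg x).
by apply: ereal_sup_le => _ [h /= hf <-]; exists h => // x; exact: le_trans (fg x).
Qed.

Lemma open_strip_open (R : realType) (T : \bar R) : open (open_strip T).
Proof.
rewrite (_ : open_strip T = fst @^-1` [set t : R | 0 < t /\ (t%:E < T)%E])//.
apply: open_comp; first by move=> *; exact: cvg_fst.
rewrite (_ : [set t : R | _] = [set t | 0 < t] `&` [set t | (t%:E < T)%E])//.
apply: openI; first exact: open_gt.
case: T => [r||].
- rewrite (_ : [set t : R | _] = [set t : R | t < r]); first exact: open_lt.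
  by apply/seteqP; split => t /=; rewrite lte_fin.
- rewrite (_ : [set t : R | _] = setT); first exact: openT.
  by apply/seteqP; split => t//= _; rewrite ltry.
- rewrite (_ : [set t : R | _] = set0); first exact: open0.
  by apply/seteqP; split => t//=; rewrite ltNge leNye.
Qed.

Lemma measurable_open_strip (R : realType) (T : \bar R) :
  measurable (open_strip T : set (R * R)).
Proof.
rewrite (_ : open_strip T = [set t : R | 0 < t /\ (t%:E < T)%E] `*` setT); last first.
  by apply/seteqP; split => -[t x] [] //= [].
apply: measurableX => //.
case: T => [r||].
- rewrite (_ : [set t : R | _] = `]0, r[%classic)//.
  by apply/seteqP; split => t /=; rewrite in_itv/= lte_fin => /andP.
- rewrite (_ : [set t : R | _] = `]0, +oo[%classic)//.
  by apply/seteqP; split => t /=; rewrite in_itv/= andbT ltry// => -[].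
- rewrite (_ : [set t : R | _] = set0)//.
  by apply/seteqP; split => t//= [_]; rewrite ltNge leNye.
Qed.

Lemma measurable_tensor (R : realType) (theta psi : R -> R) :
  elementary theta -> elementary psi ->
  measurable_fun [set: R * R] (fun z => tensor theta psi z.1 z.2).
Proof.
move=> Et Ep; apply: measurable_funM.
- apply: measurableT_comp; last exact: measurable_fst.
  by apply: continuous_measurable_fun; exact: elementary_continuous.
- apply: measurableT_comp; last exact: measurable_snd.
  by apply: continuous_measurable_fun; exact: elementary_continuous.
Qed.

(** If [h z > 0], then [h > h z / 2] on a ball inside [S], a product of two intervals of positive
    length, so the integral is positive. *)
Lemma continuous_ge0_Rintegral_le0 (R : realType) (S : set (R * R))
    (h : R * R -> R) (a b p q B : R) (z : R * R) :
  open S -> (forall z, S z -> 0 <= h z <= B) ->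
  (forall z, S z -> ~ (`[a, b] `*` `[p, q]) z -> h z = 0) ->
  \int[(@lebesgue_measure R \x @lebesgue_measure R)%E]_(z in S) h z <= 0 ->
  S z -> {for z, continuous h} -> h z = 0.
Proof.
move=> oS hB h0 hint Sz hz.
have int_prod c (A A' : set R) : 0 <= c -> measurable A -> measurable A' ->
    (\int[(@lebesgue_measure R \x @lebesgue_measure R)%E]_y (c%:E * (\1_(A `*` A') y)%:E)
     = c%:E * (@lebesgue_measure R A * @lebesgue_measure R A'))%E.
  move=> c0 mA mA'; have mAA : measurable (A `*` A') by exact: measurableX.
  rewrite ge0_integralZl_EFin//; last first.
    by apply/measurable_EFinP; exact: measurable_indic.
  congr (_ * _)%E; rewrite integral_indic// setIT.
  exact: product_measure1E.
have hS_ge0 y : (0 <= ((EFin \o h) \_ S) y)%E.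
  by rewrite patchE; case: ifPn => // /set_mem/hB/andP[? _]; rewrite lee_fin.
have B0 : 0 <= B by have /andP[h1 h2] := hB _ Sz; exact: le_trans h2.
have int_itv (r s : R) : (@lebesgue_measure R `[r, s] < +oo)%E.
  by rewrite lebesgue_measure_itv/=; case: ifP => _; rewrite ?ltry.
(* The bound [B] and the box make the extended integral finite; otherwise the hypothesis on its
   [fine] would be compatible with the value [+oo]. *)
have hoo : (\int[(@lebesgue_measure R \x @lebesgue_measure R)%E]_(y in S)
    (h y)%:E < +oo)%E.
  rewrite integral_mkcond.
  apply: (@le_lt_trans _ _ (\int[(@lebesgue_measure R \x @lebesgue_measure R)%E]_y
      (B%:E * (\1_(`[a, b] `*` `[p, q]) y)%:E))%E).
    apply: le_integral_ge0 => // y; rewrite patchE; case: ifPn => Sy.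
      have /andP[hy0 hyB] := hB y (set_mem Sy).
      have [Ky|Ky] := boolP (y \in `[a, b] `*` `[p, q]).
        by rewrite indicE Ky mule1 lee_fin.
      rewrite indicE (negbTE Ky) mule0 lee_fin h0//; first exact: set_mem.
      by move=> /mem_set; apply/negP.
    by rewrite mule_ge0// lee_fin.
  rewrite int_prod// lte_mul_pinfty//.
  by rewrite lte_mul_pinfty// ge0_fin_numE.
apply/eqP; rewrite eq_le; have /andP[-> _] := hB _ Sz; rewrite andbT leNgt.
apply/negP => hz0.
have : \forall y \near z, S y /\ h z / 2 < h y.
  apply: filterI; first exact: open_nbhs_nbhs.
  by apply: (cvgr_gt _ hz); rewrite ltr_pdivrMr// ltr_pMr// ltr1n.
move=> /nbhs_ballP[/= e e0 eS].
have : (\int[(@lebesgue_measure R \x @lebesgue_measure R)%E]_(y in S) (h y)%:E <= 0)%E.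
  rewrite -[leLHS]fineK ?lee_fin// ge0_fin_numE// integral_mkcond.
  by apply: integral_ge0 => y _; exact: hS_ge0.
apply/negP; rewrite -ltNge.
apply: (@lt_le_trans _ _ (\int[(@lebesgue_measure R \x @lebesgue_measure R)%E]_y
    ((h z / 2)%:E * (\1_(ball z.1 e `*` ball z.2 e) y)%:E))%E).
  rewrite int_prod; [|by rewrite divr_ge0// ltW|exact: measurable_ball..].
  by rewrite !lebesgue_measure_ball ?ltW// !mule_gt0// lte_fin ?divr_gt0// mulrn_wgt0.
rewrite [leRHS]integral_mkcond; apply: le_integral_ge0 => y.
  by rewrite mule_ge0// lee_fin// divr_ge0// ltW.
rewrite indicE; have [yb|yb] := boolP (y \in _); last by rewrite mule0.
have [Sy hy] := eS y (set_mem yb).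
by rewrite patchE (mem_set Sy) mule1 lee_fin ltW.
Qed.

(** The weight is nonnegative for [|x| <= N] and 0 for [N + 2 <= |x|]. In the layers between, where
    its sign is unknown, [u t] vanishes and hence so does [ux t] almost everywhere. *)
Lemma Rintegral_energy_ge0 (R : realType) (T : \bar R) (u ux : R -> R -> R)
    (theta dpsi : R -> R) (a b N : R) :
  (forall t, a < t < b -> in_H1 (u t) (ux t)) ->
  (forall t x, a < t < b -> N <= `|x| -> u t x = 0) ->
  measurable_fun (open_strip T) (uncurry ux) ->
  elementary theta -> elementary dpsi ->
  (forall t, 0 <= theta t) -> (forall t, ~~ (a < t < b) -> theta t = 0) ->
  (forall x, `|x| <= N -> 0 <= dpsi x) ->
  (forall x, N + 2 <= `|x| -> dpsi x = 0) ->
  0 <= \int[(@lebesgue_measure R \x @lebesgue_measure R)%E]_(z in open_strip T)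
         (ux z.1 z.2 ^+ 2 * tensor theta dpsi z.1 z.2).
Proof.
move=> H1 u0 mux Et Ep theta_ge0 theta0 dpsi_ge0 dpsi0.
pose f z := ux z.1 z.2 ^+ 2 * tensor theta dpsi z.1 z.2.
have mS := measurable_open_strip _ T.
have mf : measurable_fun (open_strip T) f.
  apply: measurable_funM.
    apply: measurable_funX.
    by rewrite (_ : (fun z => _) = uncurry ux)//; apply/funext => -[].
  exact: measurable_funS (measurable_tensor _ _ _ Et Ep).
(* Once [f = |f|] almost everywhere, the real integral is [fine] of a nonnegative quantity, hence
   nonnegative even if that quantity is infinite. *)
suff aef : ae_eq (@lebesgue_measure R \x @lebesgue_measure R)%E (open_strip T)
    (EFin \o f) (fun z => `|f z|%:E).
  have mf' : measurable_fun (open_strip T) (EFin \o f) by exact/measurable_EFinP.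
  have mg : measurable_fun (open_strip T) (fun z => `|f z|%:E).
    by apply/measurable_EFinP; exact: measurableT_comp.
  have Efg := @ae_eq_integral _ _ _ (@lebesgue_measure R \x @lebesgue_measure R)%E
    _ _ _ mS mf' mg aef.
  rewrite -/(f _) /Rintegral [X in fine X]Efg.
  by apply: fine_ge0; apply: integral_ge0 => z _; rewrite lee_fin.
pose E := open_strip T `&` f @^-1` `]-oo, 0[.
have mE : measurable E by exact: mf.
exists E; split => //; last first.
  move=> z /= /not_implyP[Sz fz]; split => //=; rewrite in_itv/= ltNge.
  by apply: contra_notN fz => fz; rewrite ger0_norm.
(* The product measure of [E] is the integral over [t] of the measures of its sections, so it is
   enough that every section is null. *)
apply: integral0_eq => t _ /=.
have mEt : measurable (xsection E t) by exact: measurable_xsection.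
have Esub x : xsection E t x -> ux t x ^+ 2 * (theta t * dpsi x) < 0.
  by rewrite /xsection/= inE => -[_]; rewrite /f /tensor/= in_itv.
have [tab|tab] := boolP (a < t < b); last first.
  rewrite (_ : xsection E t = set0) ?measure0//.
  by apply/seteqP; split => // x /Esub; rewrite theta0// mul0r mulr0 ltxx.
have aeR := weak_derivative_local _ _ _ N (N + 2) (H1 t tab) _.
have aeL := weak_derivative_local _ _ _ (- (N + 2)) (- N) (H1 t tab) _.
have {}aeR : {ae @lebesgue_measure R, forall x : R, N < x < N + 2 -> ux t x = 0}.
  apply: aeR => x /andP[Nx _]; apply: u0 => //.
  exact: le_trans (ltW Nx) (ler_norm _).
have {}aeL : {ae @lebesgue_measure R, forall x : R, - (N + 2) < x < - N -> ux t x = 0}.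
  apply: aeL => x /andP[_ xN]; apply: u0 => //.
  by rewrite -normrN (le_trans _ (ler_norm _))// lerNr ltW.
apply/negligibleP => //.
apply: negligibleS (negligibleU aeR aeL) => x /Esub neg.
apply: contrapT => /not_orP[/contrapT /= xR /contrapT /= xL].
suff : 0 <= ux t x ^+ 2 * (theta t * dpsi x) by rewrite leNgt neg.
have [xN|Nx] := leP `|x| N.
  by rewrite mulr_ge0 ?sqr_ge0// mulr_ge0// dpsi_ge0.
have [xN2|N2x] := leP (N + 2) `|x|; first by rewrite dpsi0// !mulr0.
suff -> : ux t x = 0 by rewrite expr0n/= mul0r.
have [x0|x0] := leP 0 x.
  by apply: xR; rewrite -(ger0_norm x0) Nx.
by apply: xL; rewrite -[x]opprK -(ltr0_norm x0) !ltrN2 Nx N2x.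
Qed.

Lemma exp_plateau (R : realType) (r : R) :
  exists psi : R -> R, [/\ elementary psi, forall x, 0 <= psi x,
    forall x, ~~ (- (r + 1) < x < r + 1) -> psi x = 0 &
    forall x, - r < x < r -> psi x = expR x].
Proof.
exists (fun x => cutoff (- (r + 1)) (r + 1) 1 x * expR x); split.
- by apply: elementaryM; [exact: elementary_cutoff|exact: elementary_expR].
- by move=> x; rewrite mulr_ge0 ?cutoff_ge0 ?expR_ge0.
- by move=> x xr; rewrite cutoff_out ?mul0r.
- move=> x /andP[rx xr]; rewrite cutoff_in ?mul1r ?ltr01// invr1.
  by apply/andP; split; lra.
Qed.

(** * Consequences of the equation *)

Lemma DGH_continuous_at (R : realType) (omega gamma : R) (T : \bar R)
    (u ux : R -> R -> R) (z : R * R) :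
  DGH_solution omega gamma T u ux -> open_strip T z ->
  {for z, continuous (uncurry u)}.
Proof.
move=> [cu _ _ _ _] Sz.
have cS : {within open_strip T, continuous (uncurry u)}.
  by apply: continuous_subspaceW cu => -[t x] [/= /ltW].
rewrite continuous_open_subspace in cS; last exact: open_strip_open.
by apply: cS; exact/mem_set.
Qed.

Lemma DGH_continuous_section (R : realType) (omega gamma : R) (T : \bar R)
    (u ux : R -> R -> R) (t : R) :
  DGH_solution omega gamma T u ux -> 0 <= t -> (t%:E < T)%E ->
  continuous (u t).
Proof.
move=> [/subspace_continuousP cu _ _ _ _] t0 tT x.
have /cu : halfopen_strip T (t, x) by [].
move=> cux A nA; have [[P Q] /= [Pt Qx] PQ] := cux A nA.
suff : nbhs x (u t @^-1` A) by [].
apply: filterS Qx => y Qy; apply: (PQ (t, y)) => //.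
by split => //=; exact: nbhs_singleton.
Qed.

(** The length of the word enters only through the sign [(-1)^|w|], so words of lengths 3 and 1 can
    be exchanged. *)
Lemma eq_dist_deriv (R : realType) (T : \bar R) (w w' : seq direction)
    (f phi : R -> R -> R) : odd (size w) = odd (size w') ->
  (forall z, open_strip T z ->
    f z.1 z.2 * pderivs w phi z.1 z.2 = f z.1 z.2 * pderivs w' phi z.1 z.2) ->
  dist_deriv T w f phi = dist_deriv T w' f phi.
Proof.
move=> ww' E; rewrite /dist_deriv -signr_odd ww' signr_odd.
by congr (_ * _); apply: eq_Rintegral => z /set_mem; exact: E.
Qed.

(* When [(1 - d_x^2) phi_t] and [(1 - d_x^2) phi_x] vanish where [u] does not,
   the linear terms cancel because [2 omega + gamma = 0], and the quadratic ones
   add up to the flux of [u^2 + u_x^2 / 2]. *)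
Lemma DGH_energy_identity (R : realType) (omega gamma : R) (T : \bar R)
    (u ux phi : R -> R -> R) :
  DGH_solution omega gamma T u ux -> omega + gamma / 2 = 0 ->
  test_function2 T phi ->
  (forall z, open_strip T z -> u z.1 z.2 * pderivs [:: Dt; Dx; Dx] phi z.1 z.2 =
    u z.1 z.2 * pderivs [:: Dt] phi z.1 z.2) ->
  (forall z, open_strip T z -> u z.1 z.2 * pderivs [:: Dx; Dx; Dx] phi z.1 z.2 =
    u z.1 z.2 * pderivs [:: Dx] phi z.1 z.2) ->
  2 * dist_deriv T [:: Dx] (fun t x => u t x ^+ 2) phi =
  - dist_deriv T [:: Dx] (fun t x => ux t x ^+ 2) phi.
Proof.
move=> sol og Tphi phit phix; have := DGH_equation sol Tphi; cbv zeta.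
rewrite (eq_dist_deriv _ _ [:: Dt; Dx; Dx] [:: Dt] u)//.
rewrite (eq_dist_deriv _ _ [:: Dx; Dx; Dx] [:: Dx] u)//.
rewrite (eq_dist_deriv _ _ [:: Dx; Dx; Dx] [:: Dx] (fun t x => u t x ^+ 2))//; last first.
  by move=> z Sz; rewrite expr2 -mulrA phix// mulrA.
move: (dist_deriv T _ _ _) (dist_deriv T _ _ _) (dist_deriv T _ _ _) (dist_deriv T _ _ _).
move: og; clear; move=> og A B C D.
(* The products of [gamma] with the value of [u_x] now cancel as monomials. What remains is linear,
   with [3/2 - 1/2 = 1] in front of the [u^2] term. *)
have -> : omega = - (gamma / 2) by lra.
lra.
Qed.

(** The [u_x^2] part of the identity is nonnegative, so the [u^2] part is at most 0. Its integrand
    is nonnegative, bounded and continuous, hence 0, while both [theta] and [e^x] are positive. *)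
Lemma DGH_vanishing (R : realType) (omega gamma : R) (T : \bar R)
    (u ux : R -> R -> R) (a b N M : R) :
  DGH_solution omega gamma T u ux -> omega + gamma / 2 = 0 ->
  0 < a -> (b%:E < T)%E ->
  (forall t x, a < t < b -> `|u t x| <= M) ->
  (forall t x, a < t < b -> N <= `|x| -> u t x = 0) ->
  forall t x, a < t < b -> u t x = 0.
Proof.
move=> sol og a0 bT uM u0 t x tab.
(* The radius [N + 1] makes [psi] agree with [exp] on an open interval containing [|x| <= N], so all
   its derivatives agree with [exp] there too. *)
have [psi [Ep psi_ge0 psi0 psiE]] := exp_plateau R (N + 1).
(* With steepness 1 there is no plateau when [b - a < 2]; positivity on []a, b[] is what counts. *)
have theta0 s : ~~ (a < s < b) -> cutoff a b 1 s = 0 by move=> ?; exact: cutoff_out.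
have theta_ge0 s : 0 <= cutoff a b 1 s by exact: cutoff_ge0.
have Et : elementary (cutoff a b 1) by exact: elementary_cutoff.
move: (cutoff a b 1) (cutoff_le1 R a b 1) (fun s => cutoff_gt0 R a b 1 s ltr01)
  theta0 theta_ge0 Et
  => theta theta_le1 theta_gt0 theta0 theta_ge0 Et.
have dtheta0 s : ~~ (a < s < b) -> derive1 theta s = 0.
  move=> sab; apply: derive1_at_zero_min => //; last exact: theta0.
  by move=> ?; exact: elementary_derivable.
have dpsi0 y : ~~ (- (N + 1 + 1) < y < N + 1 + 1) -> derive1 psi y = 0.
  move=> yN; apply: derive1_at_zero_min => //; last exact: psi0.
  by move=> ?; exact: elementary_derivable.
have E1 := elementary_derive1 _ _ Ep.
have E2 := elementary_derive1 _ _ E1.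
have P1 := eq_derive1_itv _ _ _ _ _ psiE; rewrite derive1_expR in P1.
have P2 := eq_derive1_itv _ _ _ _ _ P1; rewrite derive1_expR in P2.
have P3 := eq_derive1_itv _ _ _ _ _ P2; rewrite derive1_expR in P3.
have inN y : `|y| <= N -> - (N + 1) < y < N + 1.
  by rewrite ler_norml => /andP[? ?]; apply/andP; split; lra.
have u0' s y : a < s < b -> u s y != 0 -> `|y| < N.
  by move=> sab; apply: contra_neqT; rewrite -leNgt; exact: u0.
have weight0 (th f : R -> R) s y : (forall s, ~~ (a < s < b) -> th s = 0) ->
    ~~ (a < s < b) -> tensor th f s y = 0.
  by move=> th0 sab; rewrite /tensor th0 ?mul0r.
have weight_eq (th f g : R -> R) s y : (forall s, ~~ (a < s < b) -> th s = 0) ->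
    (forall x, - (N + 1) < x < N + 1 -> f x = expR x) ->
    (forall x, - (N + 1) < x < N + 1 -> g x = expR x) ->
    u s y * tensor th f s y = u s y * tensor th g s y.
  move=> th0 fE gE; have [sab|sab] := boolP (a < s < b); last by rewrite !weight0.
  have [->|/(u0' _ _ sab)/ltW/inN yN] := eqVneq (u s y) 0; first by rewrite !mul0r.
  by rewrite /tensor fE ?gE// yN.
have S1 := pderiv_Dx_tensor _ theta _ Ep.
have S2 := etrans (congr1 (pderiv Dx) S1) (pderiv_Dx_tensor _ theta _ E1).
have T1 : pderivs [:: Dt] (tensor theta psi) = tensor (derive1 theta) psi :=
  pderiv_Dt_tensor _ _ psi Et.
have T2 : pderivs [:: Dx] (tensor theta psi) = tensor theta (derive1 psi) := S1.
have T3 : pderivs [:: Dt; Dx; Dx] (tensor theta psi) =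
    tensor (derive1 theta) (derive1 (derive1 psi)) :=
  etrans (congr1 (pderiv Dt) S2) (pderiv_Dt_tensor _ _ _ Et).
have T4 : pderivs [:: Dx; Dx; Dx] (tensor theta psi) =
    tensor theta (derive1 (derive1 (derive1 psi))) :=
  etrans (congr1 (pderiv Dx) S2) (pderiv_Dx_tensor _ theta _ E2).
have energy_ge0 : 0 <=
    \int[(@lebesgue_measure R \x @lebesgue_measure R)%E]_(z in open_strip T)
      (ux z.1 z.2 ^+ 2 * tensor theta (derive1 psi) z.1 z.2).
  apply: (Rintegral_energy_ge0 R T u ux theta (derive1 psi) a b N
    _ u0 _ Et E1 theta_ge0 theta0).
  - move=> s /andP[as_ sb]; apply: (DGH_H1 sol).
      exact/ltW/(lt_trans a0).
    by apply: le_lt_trans bT; rewrite lee_fin ltW.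
  - exact: DGH_measurable sol.
  - by move=> y /inN yN; rewrite P1 ?expR_ge0.
  - move=> y yN; apply: dpsi0; rewrite -ltr_norml -leNgt.
    by apply: le_trans yN; rewrite -addrA.
have mass_le0 : \int[(@lebesgue_measure R \x @lebesgue_measure R)%E]_(z in open_strip T)
      (u z.1 z.2 ^+ 2 * tensor theta (derive1 psi) z.1 z.2) <= 0.
  have tphi := tensor_test_function2 _ _ _ _ _ _ _ _ a0 bT Et Ep theta0 psi0.
  have phit (z : R * R) : open_strip T z ->
      u z.1 z.2 * pderivs [:: Dt; Dx; Dx] (tensor theta psi) z.1 z.2 =
      u z.1 z.2 * pderivs [:: Dt] (tensor theta psi) z.1 z.2.
    by move=> _; rewrite T3 T1; exact: (weight_eq _ _ _ _ _ dtheta0 P2 psiE).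
  have phix (z : R * R) : open_strip T z ->
      u z.1 z.2 * pderivs [:: Dx; Dx; Dx] (tensor theta psi) z.1 z.2 =
      u z.1 z.2 * pderivs [:: Dx] (tensor theta psi) z.1 z.2.
    by move=> _; rewrite T4 T2; exact: (weight_eq _ _ _ _ _ theta0 P3 P1).
  have := DGH_energy_identity _ _ _ _ _ _ _ sol og tphi phit phix.
  rewrite /dist_deriv T2; move: energy_ge0; clear.
  move: (Rintegral _ _ _) (Rintegral _ _ _) => I1 I2.
  rewrite expr1; lra.
have Stx : open_strip T (t, x).
  case/andP: tab => at_ tb; split => /=; first exact: lt_trans at_.
  by apply: lt_trans bT; rewrite lte_fin.
(* The bound comes from [|u| <= M], [theta <= 1] and [psi' = e^y <= e^N] wherever [u] is nonzero. *)
have := continuous_ge0_Rintegral_le0 _ _ _ a b (- N) N (M ^+ 2 * expR N) (t, x)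
  (open_strip_open _ T) _ _ mass_le0 Stx _.
have [//|/[dup] utx /(u0' _ _ tab)/ltW/inN xN] := eqVneq (u t x) 0.
rewrite /tensor/= P1//.
move=> H; suff /eqP : u t x ^+ 2 * (theta t * expR x) = 0.
  by rewrite !mulf_eq0 (negbTE utx)/= !gt_eqF ?expR_gt0 ?theta_gt0.
apply: H.
- move=> [s y] _ /=; have [sab|sab] := boolP (a < s < b); last first.
    rewrite theta0// mul0r mulr0 lexx/= mulr_ge0 ?sqr_ge0 ?expR_ge0//.
  have [->|/(u0' _ _ sab) yN] := eqVneq (u s y) 0.
    by rewrite expr0n/= mul0r lexx/= mulr_ge0 ?sqr_ge0 ?expR_ge0.
  rewrite P1; last exact/inN/ltW.
  rewrite mulr_ge0 ?sqr_ge0 ?mulr_ge0 ?expR_ge0//=.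
  rewrite ler_pM ?sqr_ge0 ?mulr_ge0 ?expR_ge0//.
    rewrite -(real_normK (num_real (u s y))) lerXn2r ?nnegrE// ?uM//.
    exact: le_trans (uM s y sab).
  rewrite -[leRHS]mul1r ler_pM ?expR_ge0// ler_expR.
  by rewrite (le_trans (ler_norm _))// ltW.
- move=> [s y] _ /= K; have [sab|sab] := boolP (a < s < b); last first.
    by rewrite theta0// mul0r mulr0.
  have [->|/(u0' _ _ sab) yN] := eqVneq (u s y) 0; first by rewrite expr0n/= mul0r.
  exfalso; apply: K; split; rewrite /= in_itv/=; last by rewrite -ler_norml ltW.
  by case/andP: sab => /ltW -> /ltW ->.
- rewrite (_ : (fun z => _) =
      (uncurry u \* uncurry u) \* uncurry (tensor theta (derive1 psi))); last first.
    by apply/funext => -[s y]; rewrite /= expr2.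
  have cu := DGH_continuous_at _ _ _ _ _ _ _ sol Stx.
  have [ct _ _] := smooth2_tensor _ _ _ Et E1 [::].
  apply: continuousM; last exact: ct.
  exact: continuousM.
Qed.

(** * Vanishing at one time, hence at all times *)

Lemma weak_derivative_eq0 (R : realType) (v vx : R -> R) :
  in_H1 v vx -> (forall x, v x = 0) ->
  {ae @lebesgue_measure R, forall x, vx x = 0}.
Proof.
move=> H v0.
have ae_n (n : nat) : {ae @lebesgue_measure R,
    forall x, - n%:R < x < n%:R -> vx x = 0}.
  by apply: weak_derivative_local H _ => x _; exact: v0.
move/ae_foralln: ae_n; apply: filterS => x vx0.
have [n xn] : exists n : nat, `|x| < n%:R.
  by exists (Num.bound `|x|); exact: archi_boundP.
by apply: (vx0 n); rewrite -ltr_norml.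
Qed.

Lemma ae_eq0_continuous (R : realType) (v : R -> R) : continuous v ->
  {ae @lebesgue_measure R, forall x, v x = 0} -> forall x, v x = 0.
Proof.
move=> cv [Z [mZ Z0 vZ]] x; apply/eqP/negPn/negP => vx0.
have : \forall y \near x, v y != 0 by exact: (cvgr_neq0 _ (cv x)).
move=> /nbhs_ballP[/= e e0 ev].
have : (@lebesgue_measure R (ball x e) <= 0)%E.
  rewrite -Z0; apply: le_measure; rewrite ?inE//; first exact: measurable_ball.
  by move=> y /ev vy; apply: vZ => /= vy0; rewrite vy0 eqxx in vy.
apply/negP; rewrite -ltNge lebesgue_measure_ball ?ltW//.
by rewrite lte_fin mulrn_wgt0.
Qed.

(** A zero norm gives [v = 0] almost everywhere, and continuity gives it everywhere. Conversely [vx]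
    is an arbitrary representative, null almost everywhere as a weak derivative of 0. *)
Lemma H1norm_eq0 (R : realType) (v vx : R -> R) : in_H1 v vx -> continuous v ->
  H1norm v vx = 0 <-> forall x, v x = 0.
Proof.
move=> H cv; have [v2 vx2 _] := H.
have iv := Lfun2_integrable_sqr v2.
have ivx := Lfun2_integrable_sqr vx2.
have i2 : (@lebesgue_measure R).-integrable [set: R]
    (fun x => (v x ^+ 2 + vx x ^+ 2)%:E).
  have -> : (fun x => (v x ^+ 2 + vx x ^+ 2)%:E) =
      ((fun x => (v x ^+ 2)%:E) \+ (fun x => (vx x ^+ 2)%:E))%E.
    by apply/funext => x; rewrite EFinD.
  exact: integrableD.
have ge0 x : (0 <= (v x ^+ 2 + vx x ^+ 2)%:E)%E.
  by rewrite lee_fin addr_ge0 ?sqr_ge0.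
have aeP := ae_eq_integral_abs (@lebesgue_measure R) measurableT (measurable_int _ i2).
split => [/eqP|v0].
- rewrite sqrtr_eq0 => le0; apply: ae_eq0_continuous => //.
  (* [le0] is about [fine] of the integral; integrability rules out the value [+oo]. *)
  have : (\int[@lebesgue_measure R]_x `|(v x ^+ 2 + vx x ^+ 2)%:E| = 0)%E.
    under eq_integral do rewrite gee0_abs//.
    apply/eqP; rewrite eq_le integral_ge0// andbT.
    by rewrite -[leLHS]fineK ?lee_fin// integrable_fin_num.
  move=> /aeP; apply: filterS => x /(_ Logic.I) [] /eqP.
  by rewrite paddr_eq0 ?sqr_ge0// => /andP[/eqP vx0 _]; apply/eqP; rewrite -sqrf_eq0 vx0.
- have : (\int[@lebesgue_measure R]_x `|(v x ^+ 2 + vx x ^+ 2)%:E| = 0)%E.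
    apply/aeP; move: (weak_derivative_eq0 _ _ _ H v0).
    apply: filterS; first exact: (ae_filter_ringOfSetsType (@lebesgue_measure R)).
    move=> x vx0 _ /=.
    by rewrite v0 vx0 expr0n/= addr0.
  under eq_integral do rewrite gee0_abs//.
  by rewrite /H1norm /Rintegral => ->; rewrite sqrtr0.
Qed.

(** Having a nonzero value at some [|x| >= n] is an open condition on the time. If such times were
    dense for every [n], Baire's theorem would produce one time good for all [n], against
    compactness of the support. *)
Lemma uniform_support_interval (R : realType) (u : R -> R -> R) (a b : R) :
  a < b ->
  (forall t x, a < t < b -> {for t, continuous (u ^~ x)}) ->
  (forall t, a < t < b -> compactly_supported (u t)) ->
  exists (a' b' N : R), [/\ a < a', a' < b', b' < b &
    forall t x, a' < t < b' -> N <= `|x| -> u t x = 0].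
Proof.
move=> ab cu su.
(* Baire's theorem is applied on the whole line. Adding the complement of [[a, b]] forces any open
   set missed by [U n] to lie in [[a, b]]. *)
pose U (n : nat) : set R := ~` `[a, b] `|`
  [set t | a < t < b /\ exists2 x, n%:R <= `|x| & u t x != 0].
have oU n : open (U n).
  apply: openU; first exact/closed_openC/interval_closed.
  rewrite openE => t [/andP[at_ tb] [x nx utx]]; rewrite /interior/=.
  have ct : {for t, continuous (u ^~ x)} by apply: cu; rewrite at_.
  near=> s; split; first by apply/andP; split; near: s; [exact: lt_nbhsr|exact: lt_nbhsl].
  by exists x => //; near: s; exact: (cvgr_neq0 _ ct).
have [n nU] : exists n, ~ dense (U n).
  apply: contrapT => /forallNP dU.
  have /(_ `]a, b[) [||s [/= sab sU]] := Baire (fun n => conj (oU n) (contrapT (dU n))).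
  - by exists ((a + b) / 2); rewrite /= in_itv/=; apply/andP; split; lra.
  - exact: interval_open.
  rewrite in_itv/= in sab.
  (* Every real above [B] bounds the support, whence [B + 1]. *)
  have [B [_ BK]] := compact_bounded (su _ sab).
  pose k := Num.bound `|B + 1|.
  case: (sU k Logic.I) => [|[_ [x kx usx]]].
    by apply; rewrite /= in_itv/=; case/andP: sab => /ltW -> /ltW ->.
  have : `|x| <= B + 1 by apply: BK; [rewrite ltrDl|exact: subset_closure].
  apply/negP; rewrite -ltNge (lt_le_trans _ kx)//.
  exact: le_lt_trans (ler_norm _) (archi_boundP _).
have [W /not_implyP[[s0 Ws0] /not_implyP[oW WU]]] := (existsNP _).2 nU.
have /nbhs_ballP[/= e e0 eW] : nbhs s0 W by exact: open_nbhs_nbhs.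
have WP s : W s -> a <= s <= b /\ (a < s < b -> forall x, n%:R <= `|x| -> u s x = 0).
  move=> Ws; split.
    apply: contrapT => sab; apply: WU; exists s; split => //; left => /=.
    by rewrite in_itv.
  move=> sab x nx; apply: contrapT => /eqP usx; apply: WU; exists s; split => //.
  by right; split => //; exists x.
have half d : `|d| < e -> W (s0 + d).
  by move=> de; apply: eW; rewrite /ball/= opprD addNKr normrN.
(* The points [s0 - e / 2] and [s0 + e / 2] are in [[a, b]], so the smaller radius [e / 4] gives an
   interval strictly inside []a, b[]. *)
have e2 : `|- (e / 2)| < e by rewrite normrN gtr0_norm ?divr_gt0//; lra.
have e2' : `|e / 2| < e by rewrite -normrN.
have [/andP[l1 _] _] := WP _ (half _ e2).
have [/andP[_ l2] _] := WP _ (half _ e2').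
exists (s0 - e / 4), (s0 + e / 4), n%:R; split; [lra|lra|lra|].
move=> t x /andP[t1 t2].
have Wt : W t.
  have -> : t = s0 + (t - s0) by lra.
  apply: half.
  by rewrite ltr_norml; apply/andP; split; lra.
by apply: (WP t Wt).2; apply/andP; split; lra.
Unshelve. all: by end_near.
Qed.

Theorem theorem2p3 (R : realType) (omega gamma : R) (T : \bar R)
    (u ux : R -> R -> R)
    (T_gt0 : (0 < T)%E)
    (u_sol : DGH_solution omega gamma T u ux)
    (u_bounded : exists M : R, forall t x : R,
       0 <= t -> (t%:E < T)%E -> `|u t x| <= M)
    (u_C1 : forall t : R, 0 <= t -> (t%:E < T)%E ->
       differentiable_on_line (helmholtz_inv (u t)) /\
       C1 (derive1 (helmholtz_inv (u t))))
    (u_H1_const : forall s t : R, 0 <= s -> (s%:E < T)%E ->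
       0 <= t -> (t%:E < T)%E -> H1norm (u s) (ux s) = H1norm (u t) (ux t))
    (omega_gamma : omega + gamma / 2 = 0)
    (u_supp : forall t : R, 0 <= t -> (t%:E < T)%E ->
       compactly_supported (u t)) :
  forall t x : R, 0 <= t -> (t%:E < T)%E -> u t x = 0.
Proof.
have [M uM] := u_bounded.
(* [T] may be infinite; a real [c] below it gives a bounded interval of times to work on. *)
have [c [c0 cT]] : exists c : R, 0 < c /\ (c%:E < T)%E.
  case: T T_gt0 {u_sol u_bounded u_C1 u_H1_const u_supp uM} => [r|_|//].
    by rewrite lte_fin => r0; exists (r / 2); rewrite lte_fin; split; lra.
  by exists 1; rewrite ltry.
have inT t : 0 < t < c -> 0 <= t /\ (t%:E < T)%E.
  move=> /andP[t0 tc]; split; first exact: ltW.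
  by apply: lt_trans cT; rewrite lte_fin.
have cu t x : 0 < t < c -> {for t, continuous (u ^~ x)}.
  move=> /[dup] /andP[t0 _] /inT[_ tT].
  have ct : {for (t, x), continuous (uncurry u)}.
    by apply: (DGH_continuous_at _ _ _ T _ _ _ u_sol); split.
  apply: (@continuous_comp _ _ _ (fun s => (s, x)) (uncurry u)) => //.
  move=> A [[P Q] /= [Pt Qx] PQ]; suff : nbhs t [set s | A (s, x)] by [].
  by apply: filterS Pt => s Ps; apply: (PQ (s, x)); split=> //; exact: nbhs_singleton.
have [|a [b [N [a0 ab bc uN]]]] := uniform_support_interval _ u 0 c c0 cu.
  by move=> t /inT[t0 tT]; exact: u_supp.
have bT : (b%:E < T)%E by apply: lt_trans cT; rewrite lte_fin.
have abT t : a < t < b -> 0 <= t /\ (t%:E < T)%E.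
  by move=> /andP[at_ tb]; apply: inT; rewrite (lt_trans a0)//= (lt_trans tb).
have u0 t x : a < t < b -> u t x = 0.
  apply: (DGH_vanishing R omega gamma T u ux a b N M) => // s y /abT[s0 sT].
  exact: uM.
have mid : a < (a + b) / 2 < b by apply/andP; split; lra.
have [m0 mT] := abT _ mid.
move=> t x t0 tT; move: x.
apply/(H1norm_eq0 _ _ _ (DGH_H1 u_sol t0 tT)
  (DGH_continuous_section _ _ _ _ _ _ _ u_sol t0 tT)).
rewrite (u_H1_const t ((a + b) / 2))//.
apply/(H1norm_eq0 _ _ _ (DGH_H1 u_sol m0 mT)
  (DGH_continuous_section _ _ _ _ _ _ _ u_sol m0 mT)).
by move=> x; exact: u0.
Qed.
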